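(* The chromatic number of $\mathbb{H}_{\mathbb{N}^{\mathbb{N}}}$ is $\mathrm{cov}(\mathcal{M})$.
   Context: Working in $\mathsf{ZFC}$. For $t\in\mathbb{N}^{<\mathbb{N}}$ (finite sequences of naturals), $\mathcal{N}_t=\{b\in\mathbb{N}^{\mathbb{N}} : t\sqsubseteq b\}$, and $t\cdot(n)$ is $t$ followed by the single entry $n$. $\mathbb{H}_{\mathbb{N}^{\mathbb{N}}}=\bigcup_{t\in\mathbb{N}^{<\mathbb{N}}}\prod_{n\in\mathbb{N}}\mathcal{N}_{t\cdot(n)}$, an $\mathbb{N}$-dimensional dihypergraph on $\mathbb{N}^{\mathbb{N}}$ (i.e., a set of non-constant sequences of elements of $\mathbb{N}^{\mathbb{N}}$). The chromatic number of a dihypergraph $H$ on $X$ is the least cardinal $\kappa$ for which there is a map from $X$ to a set of cardinality $\kappa$ that is non-constant along every element of $H$. $\mathcal{M}$ is the $\sigma$-ideal of meager subsets of $\mathbb{R}$, and $\mathrm{cov}(\mathcal{M})$ is the least cardinality of a family of meager sets whose union is $\mathbb{R}$. *)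

(* Defs.v *)
From mathcomp Require Import all_boot all_order all_algebra.
From mathcomp Require Import all_classical all_reals.
From mathcomp Require Import topology normedtype.

Set Implicit Arguments.
Unset Strict Implicit.
Unset Printing Implicit Defensive.

Import numFieldNormedType.Exports.

Local Open Scope classical_set_scope.
Local Open Scope card_scope.

Definition nonconstant (X : Type) (e : nat -> X) : Prop :=
  ~ exists x, forall n, e n = x.

(* Only dihypergraphs of dimension nat are needed. *)
Record dihypergraph (X : Type) := Dihypergraph {
  edges : set (nat -> X);
  edges_nonconstant : forall e, edges e -> nonconstant e
}.

(* Cardinals are represented by types up to equipotence; P is meant to be
   invariant under equipotence, and the K below is then unique up to
   equipotence by the Cantor-Bernstein theorem. *)
Definition least_cardinal (P : Type -> Prop) (K : Type) : Prop :=
  P K /\ forall L : Type, P L -> [set: K] #<= [set: L].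

Definition coloring (X : Type) (H : dihypergraph X) (K : Type) (c : X -> K) :
  Prop := forall e, edges H e -> nonconstant (c \o e).

Definition is_chromatic_number (X : Type) (H : dihypergraph X) :
    Type -> Prop :=
  least_cardinal (fun K => exists c : X -> K, coloring H c).

(* [mkseq b k] is the sequence b 0, ..., b (k - 1). *)
Definition basic_nbhs (t : seq nat) : set (nat -> nat) :=
  [set b | mkseq b (size t) = t].

Definition H_baire_edges : set (nat -> nat -> nat) :=
  \bigcup_(t in [set: seq nat])
    [set e | forall n, basic_nbhs (rcons t n) (e n)].

Lemma H_baire_nonconstant e : H_baire_edges e -> nonconstant e.
Proof.
move=> [t _ et] [x ex].
have xt n : x (size t) = n.
  have := et n; rewrite /basic_nbhs/= ex size_rcons => /(congr1 (nth 0 ^~ (size t))).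
  by rewrite nth_mkseq// nth_rcons ltnn eqxx.
by have := xt 0; rewrite (xt 1).
Qed.

Definition H_baire : dihypergraph (nat -> nat) :=
  Dihypergraph H_baire_nonconstant.

Definition nowhere_dense (T : topologicalType) (A : set T) : Prop :=
  interior (closure A) = set0.

Definition meager (T : topologicalType) (A : set T) : Prop :=
  exists F : nat -> set T,
    (forall n, nowhere_dense (F n)) /\ A = \bigcup_n F n.

Definition is_cov_meager (R : realType) : Type -> Prop :=
  least_cardinal (fun K => exists F : set (set R),
    [/\ forall A, F A -> meager A,
        \bigcup_(A in F) A = [set: R] &
        F #= [set: K]]).

(* Main.v *)
(* A set A of sequences is sparse when every t has a child t.n whose cylinder
   misses A. A map on the Baire space is a coloring of the dihypergraph iff its
   fibers are sparse, and sparse sets turn out to be interchangeable with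
   nowhere dense sets of reals.

   Let the children of a rational interval enumerate all its rational
   subintervals: sending b to a point of the nested intersection along b defines
   a map from the Baire space to R under which preimages of nowhere dense sets
   are sparse. Hence a cover of R by L meager sets yields a coloring with
   L x nat colors. As nat does not suffice as a set of colors, L is infinite and
   L x nat is equipotent with L.

   Conversely, let [zero_run x k] be the length of the run of zeros that starts
   at position k in the binary expansion of x. Fixing the digits up to a digit 1
   at position l determines the first l + 1 values while the next one is still
   arbitrary, so preimages of sparse sets are nowhere dense and the fibers of a coloring with
   K colors pull back to K nowhere dense sets covering R. *)
Require Import Defs.
From mathcomp Require Import all_boot all_order all_algebra.
From mathcomp Require Import all_classical all_reals.
From mathcomp Require Import topology normedtype.
From mathcomp Require Import lra zify.

Set Implicit Arguments.
Unset Strict Implicit.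
Unset Printing Implicit Defensive.

Import Order.TTheory GRing.Theory Num.Theory numFieldNormedType.Exports.

Local Open Scope classical_set_scope.
Local Open Scope card_scope.

(** * Comparison of cardinalities *)

Lemma card_leTP (T U : Type) (B : set U) :
  [set: T] #<= B <-> exists f : T -> U, injective f /\ forall x, B (f x).
Proof.
split=> [/card_leP[f]|[f [finj fB]]].
  exists (fun x => val (f (exist _ x (in_setT x)))); split=> [x y|x].
    by move=> /val_inj /inj H; have := H (in_setT _) (in_setT _) => -[].
  exact/set_mem/valP.
have <- : f @^-1` B = [set: T] by rewrite -subTset => x _; exact: fB.
by apply: card_ge_preimage => x y _ _; exact: finj.
Qed.

Lemma card_leTTP (T U : Type) :
  [set: T] #<= [set: U] <-> exists f : T -> U, injective f.
Proof.
by rewrite card_leTP; split=> [[f [finj _]]|[f finj]]; exists f.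
Qed.

(* A maximal set of choice functions on which all coordinates are injective
   has a surjective coordinate. *)
Lemma exists_least_card (I : Type) (T : I -> Type) (i0 : I) :
  exists i, forall j, [set: T i] #<= [set: T j].
Proof.
pose P (Z : set (forall i, T i)) :=
  forall f g i, Z f -> Z g -> f i = g i -> f = g.
have [|Z [PZ Zmax]] := @Zorn_bigcup _ P.
  move=> F FP Ftot f g i [A FA Af] [B FB Bg].
  by have [AB|BA] := Ftot _ _ FA FB; [apply: (FP _ FB)|apply: (FP _ FA)];
     auto.
have [i isurj] : exists i, forall x : T i, exists f, Z f /\ f i = x.
  apply: contrapT => /forallNP nsurj.
  have /all_sig[h hP] i : {x : T i | forall f, Z f -> f i <> x}.
    apply: cid; have /existsNP[x xP] := nsurj i.
    by exists x => f Zf fx; apply: xP; exists f.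
  apply: (Zmax (Z `|` [set h])).
    split=> [|/(_ h)]; first exact: subsetUl.
    by move=> /(_ (or_intror erefl)) /(hP i0); exact.
  move=> f g i [Zf|->] [Zg|->] //; first exact: PZ.
  - by move=> /hP - /(_ Zf).
  - by move=> /esym /hP - /(_ Zg).
exists i => j; apply/card_leTTP.
have [s sP] := choice isurj.
exists (fun x => s x j) => x y /PZ sxy.
by have [[Zx <-] [Zy <-]] := (sP x, sP y); rewrite sxy.
Qed.

(* A maximal family of injections from nat with disjoint images exhausts T up
   to a finite set, which one member of the family absorbs. *)
Lemma infinite_card_muln (T : Type) :
  infinite_set [set: T] -> [set: T * nat] #<= [set: T].
Proof.
move=> Tinf; pose P (F : set (nat -> T)) :=
  forall g h i j, F g -> F h -> g i = h j -> g = h /\ i = j.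
have [|F [PF Fmax]] := @Zorn_bigcup _ P.
  move=> G GP Gtot g h i j [A GA Ag] [B GB Bh].
  by have [AB|BA] := Gtot _ _ GA GB; [apply: (GP _ GB)|apply: (GP _ GA)];
     auto.
pose rest := [set x | forall g i, F g -> g i <> x].
have rest_fin : finite_set rest.
  apply: contrapT => /infiniteP /card_leTP[h [h_inj hrest]].
  apply: (Fmax (F `|` [set h])).
    split=> [|/(_ h)]; first exact: subsetUl.
    by move=> /(_ (or_intror erefl)) /(hrest 0 h 0).
  move=> f g i j [Ff|->] [Fg|->]; first exact: PF.
  - by move=> /(hrest j f i Ff).
  - by move=> /esym /(hrest i g j Fg).
  - by move=> /h_inj ->.
have /countable_injP[r r_inj] := finite_set_countable rest_fin.
have [g0 Fg0] : F !=set0.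
  apply: contrapT => /forallNP F0; apply: Tinf; apply: sub_finite_set rest_fin.
  by move=> x _ g i /F0.
(* Parity separates two kinds of codes: even indices for points on members of [F], odd ones for the
   leftover points, which are placed on [g0]. *)
have /choice[p pP] : forall x, exists p : (nat -> T) * nat, F p.1 /\
    ((exists i, p.1 i = x /\ p.2 = i.*2) \/
     [/\ rest x, p.1 = g0 & p.2 = (r x).*2.+1]).
  move=> x; have [xr|/existsNP[g /existsNP[i]]] := pselect (rest x).
    by exists (g0, (r x).*2.+1); split=> //; right.
  move=> /not_implyP[Fg /contrapT gx]; exists (g, i.*2); split=> //.
  by left; exists i.
have p_inj : injective p.
  move=> x y pxy; have := pP y; have := pP x; rewrite pxy => -[_ Hx] [_ Hy].
  case: Hx => [[i [ix ei]]|[rx _ ex]]; case: Hy => [[j [jy ej]]|[ry _ ey]].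
  - by rewrite -ix -[RHS]jy; congr (_ _); apply: double_inj; rewrite -ei -ej.
  - by move: ey; rewrite ei => /(congr1 odd); rewrite /= !odd_double.
  - by move: ex; rewrite ej => /(congr1 odd); rewrite /= !odd_double.
  - apply: r_inj; rewrite ?inE//.
    by apply: double_inj; move: ex; rewrite ey => -[].
apply/card_leTTP.
exists (fun xn => (p xn.1).1 (pickle ((p xn.1).2, xn.2))) => -[x n] [y m] /=.
move=> /(PF _ _ _ _ (pP x).1 (pP y).1)[e1 /(pcan_inj pickleK)[e2 ->]].
by congr (_, _); apply: p_inj; rewrite [LHS]surjective_pairing e1 e2
  -surjective_pairing.
Qed.

(** * Sparse sets and colorings *)

Definition sparse (A : set (nat -> nat)) : Prop :=
  forall t, exists n, forall b, basic_nbhs (rcons t n) b -> ~ A b.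

Lemma sparseS (A B : set (nat -> nat)) : A `<=` B -> sparse B -> sparse A.
Proof. by move=> AB sB t; have [n nB] := sB t; exists n => b /nB; auto. Qed.

(** If the cylinder of every child of [t] meets a fiber, one point from each forms an edge on which
    [c] is constant. *)
Lemma coloringP (K : Type) (c : (nat -> nat) -> K) :
  coloring H_baire c <-> forall k, sparse (c @^-1` [set k]).
Proof.
split=> [cP k t|cP e [t _ et] [k ek]]; last first.
  by have [n nP] := cP k t; exact: nP (et n) (ek n).
apply: contrapT => /forallNP nP.
have /choice[e eP] : forall n, exists b, basic_nbhs (rcons t n) b /\ c b = k.
  by move=> n; have /existsNP[b /not_implyP[tb /contrapT]] := nP n; exists b.
apply: (cP e); first by exists t => // n; have [] := eP n.
by exists k => n; have [] := eP n.
Qed.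

Lemma basic_nbhs_rcons t n b :
  mkseq b (size t) = t -> b (size t) = n -> basic_nbhs (rcons t n) b.
Proof. by move=> tb bn; rewrite /basic_nbhs /= size_rcons mkseqS tb bn. Qed.

(** Diagonal argument: stage [k] appends an entry that avoids the fiber of color [k], so the limit
    [b] could have no color. *)
Lemma coloring_uncountable (c : (nat -> nat) -> nat) : ~ coloring H_baire c.
Proof.
move=> /coloringP cP; have /choice[m mP] := fun kt => cP kt.1 kt.2.
pose s := fix s k := if k is k'.+1 then rcons (s k') (m (k', s k')) else [::].
pose b k := m (k, s k).
have sE k : mkseq b k = s k by elim: k => //= k IH; rewrite mkseqS IH.
apply: (mP (c b, s (c b)) b) => //=.
have sz k : size (s k) = k by rewrite -sE size_mkseq.
by apply: basic_nbhs_rcons; rewrite sz.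
Qed.

Lemma coloring_infinite (K : Type) (c : (nat -> nat) -> K * nat) :
  coloring H_baire c -> infinite_set [set: K].
Proof.
move=> cP /finite_set_countable /countable_injP[f finj].
apply: (@coloring_uncountable (fun b => pickle (f (c b).1, (c b).2))).
apply/coloringP => k t.
move/coloringP: cP => cP.
have [[b0 b0k]|nk] := pselect (exists b, pickle (f (c b).1, (c b).2) = k).
  apply: (sparseS _ (cP (c b0))) => b /=.
  rewrite -b0k => /(pcan_inj pickleK)[/finj e1 e2].
  by rewrite [LHS]surjective_pairing [RHS]surjective_pairing e1 ?inE// e2.
by exists 0 => b _ bk; apply: nk; exists b.
Qed.

(** * Nowhere dense sets of reals and the map from the Baire space to the reals *)

Local Open Scope ring_scope.

Lemma nowhere_dense_itvP (R : realType) (A : set R) :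
  nowhere_dense A <-> forall a b : R, a < b ->
    exists c d, [/\ a <= c, c < d, d <= b & forall x, c <= x <= d -> ~ A x].
Proof.
split=> [A0 a b ab|AP]; last first.
  rewrite /nowhere_dense -subset0 => x /nbhs_ballP[e /= e0 xeA].
  have [|c [d [ec cd de cdA]]] := AP (x - e / 2) (x + e / 2); first by lra.
  have /xeA : ball x e ((c + d) / 2).
    by rewrite /ball /= ltr_norml; apply/andP; split; lra.
  move=> /(_ `]c, d[%classic)[].
    apply: open_nbhs_nbhs; split; first exact: itv_open.
    by rewrite /= in_itv /=; lra.
  move=> y [Ay]; rewrite /= in_itv /= => /andP[cy yd].
  by apply: (cdA y) => //; rewrite !ltW.
have [x abx Ax] : exists2 x, a < x < b & ~ closure A x.
  apply: contrapT => nA.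
  suff: (closure A)° ((a + b) / 2) by rewrite A0.
  apply/(@filterS _ _ _ `]a, b[%classic) => [x|].
    rewrite /= in_itv /= => abx; apply: contrapT => Ax; apply: nA.
    by exists x.
  by apply: open_nbhs_nbhs; split; [exact: itv_open|rewrite /= in_itv /=; lra].
have /existsNP[V /not_implyP[/nbhs_ballP[e /= e0 xeV] AV]] := Ax.
exists (Num.max a (x - e / 2)), (Num.min b (x + e / 2)).
rewrite le_max lexx ge_min lexx gt_max !lt_min; split=> //; first by lra.
move=> y; rewrite ge_max le_min => /andP[/andP[_ xy] /andP[_ yx]] Ay.
apply: AV; exists y; split=> //; apply: xeV.
by rewrite /ball /= ltr_norml; apply/andP; split; lra.
Qed.

(* [subitv t] runs through nested rational intervals; its children include all
   its nondegenerate rational subintervals. *)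
Definition subitv_step (p : rat * rat) (n : nat) : rat * rat :=
  if unpickle n is Some q then
    if [&& p.1 <= q.1, q.1 < q.2 & q.2 <= p.2] then q else p
  else p.

Definition subitv (t : seq nat) : rat * rat := foldl subitv_step (0, 1) t.

Lemma subitv_rcons t n : subitv (rcons t n) = subitv_step (subitv t) n.
Proof. exact: foldl_rcons. Qed.

Lemma subitv_pickle t q :
    [&& (subitv t).1 <= q.1, q.1 < q.2 & q.2 <= (subitv t).2] ->
  subitv (rcons t (pickle q)) = q.
Proof. by rewrite subitv_rcons /subitv_step pickleK => ->. Qed.

Lemma subitv_lt t : (subitv t).1 < (subitv t).2.
Proof.
elim/last_ind: t => [//|t n IH]; rewrite subitv_rcons /subitv_step.
by case: unpickle => // q; case: ifP => // /and3P[].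
Qed.

Lemma subitv_cat t u :
  (subitv t).1 <= (subitv (t ++ u)).1 /\ (subitv (t ++ u)).2 <= (subitv t).2.
Proof.
elim/last_ind: u => [|u n [IH1 IH2]]; first by rewrite cats0.
rewrite -rcons_cat subitv_rcons /subitv_step.
case: unpickle => // q; case: ifP => // /and3P[q1 _ q2].
by rewrite (le_trans IH1) ?(le_trans _ IH2).
Qed.

Section baire_to_real.
Variable R : realType.

(** The nested intervals need not shrink to a point, since a child may repeat its parent; the
    supremum of the left endpoints selects a point of the intersection. *)
Definition baire_real (b : nat -> nat) : R :=
  sup (range (fun k => ratr (subitv (mkseq b k)).1)).

Lemma mkseq_catl (b : nat -> nat) k l : (k <= l)%N ->
  exists u, mkseq b l = mkseq b k ++ u.
Proof.
move=> kl; exists (map b (iota k (l - k))).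
by rewrite /mkseq -map_cat -iotaD subnKC.
Qed.

Lemma subitv_mkseq_le b k l : (subitv (mkseq b k)).1 <= (subitv (mkseq b l)).2.
Proof.
have [/(mkseq_catl b)[u ->]|/ltnW/(mkseq_catl b)[u ->]] := leqP k l.
  by rewrite (le_trans (subitv_cat _ u).1)// ltW// subitv_lt.
by rewrite (le_trans _ (subitv_cat _ u).2)// ltW// subitv_lt.
Qed.

Lemma baire_real_itv t b : basic_nbhs t b ->
  ratr (subitv t).1 <= baire_real b <= ratr (subitv t).2.
Proof.
move=> <-; set k := size t; rewrite /baire_real; set E := (X in sup X).
have Eub l : ubound E (ratr (subitv (mkseq b l)).2).
  by move=> _ [i _ <-]; rewrite ler_rat subitv_mkseq_le.
have E0 : E !=set0 by exists (ratr (subitv (mkseq b 0)).1), 0%N.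
apply/andP; split; last exact: ge_sup.
apply: sup_upper_bound; last by exists k.
by split=> //; exists (ratr (subitv (mkseq b 0)).2).
Qed.

Lemma sparse_baire_real (A : set R) : nowhere_dense A ->
  sparse (baire_real @^-1` A).
Proof.
move=> /nowhere_dense_itvP AP t.
have [|c [d [tc cd dt cdA]]] := AP (ratr (subitv t).1) (ratr (subitv t).2).
  by rewrite ltr_rat subitv_lt.
(* A rational interval inside [[c, d]] is a child of [t], and every branch through it is sent into
   it. *)
have [p] := rat_in_itvoo cd; rewrite in_itv /= => /andP[cp pd].
have [q] := rat_in_itvoo pd; rewrite in_itv /= => /andP[pq qd].
exists (pickle (p, q)) => b /baire_real_itv.
rewrite subitv_pickle /=; last first.
  rewrite -!(ler_rat R) -(ltr_rat R) pq (le_trans tc) ?ltW//.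
  by rewrite (lt_le_trans qd).
move=> /andP[pb bq]; apply: cdA.
by rewrite (le_trans (ltW cp))// (le_trans bq)// ltW.
Qed.

End baire_to_real.

(** * Binary digits and the map from the reals to the Baire space *)

Section real_to_baire.
Variable R : realType.
Implicit Types (x y : R) (k l n : nat) (m : int).

Definition dyadic_floor l x : int := Num.floor (2 ^+ l * x).

Lemma dyadic_floorP l x m :
  dyadic_floor l x = m <-> m%:~R <= 2 ^+ l * x < (m + 1)%:~R.
Proof. by rewrite -floor_eq; split=> [<-|/eqP]. Qed.

Lemma dyadic_floor_div k l x :
  dyadic_floor k x = (dyadic_floor (k + l) x %/ 2 ^+ l)%Z.
Proof.
have /dyadic_floorP := erefl (dyadic_floor (k + l) x).
set f := dyadic_floor (k + l) x => /andP[fx xf]; apply/dyadic_floorP.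
have p0 : 0 < 2 ^+ l :> int by rewrite exprn_gt0.
have q1 := lez_floor f (lt0r_neq0 p0).
have q2 := ltz_ceil f p0.
have pow2E : 2 ^+ l = (2 ^+ l : int)%:~R :> R by rewrite rmorphXn.
rewrite -(ler_pM2l (_ : 0 < 2 ^+ l :> R)) ?exprn_gt0//.
rewrite -(ltr_pM2l (_ : 0 < 2 ^+ l :> R)) ?exprn_gt0//.
rewrite mulrA -exprD (addnC l) (le_trans _ fx) ?(lt_le_trans xf)//.
  rewrite pow2E -intrM ler_int; lia.
by rewrite pow2E -intrM ler_int mulrC.
Qed.

(** The binary digit of [x] at position [l] is 1; the absolute value preserves parity, so negative
    [x] are covered. *)
Definition dyadic_odd l x := odd `|dyadic_floor l x|.

(* The length of the run of zeros that starts at position [k] in the binary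
   expansion of [x]; 0 if this run is infinite. *)
Definition zero_run x k : nat :=
  if pselect (exists n, dyadic_odd (k + n) x) is left ex
  then ex_minn ex else 0%N.

Lemma zero_runE x k n : dyadic_odd (k + n) x ->
  (forall i, (i < n)%N -> ~~ dyadic_odd (k + i) x) -> zero_run x k = n.
Proof.
move=> nodd even; rewrite /zero_run; case: pselect => [ex|[]]; last by exists n.
case: ex_minnP => i iodd imin; apply/eqP; rewrite eqn_leq imin//= leqNgt.
by apply/negP => /even; rewrite iodd.
Qed.

(** The digit 1 at position [l] ends every run that starts at or before [l], and the common floor
    fixes all digits up to there. *)
Lemma zero_run_local l x y k : (k <= l)%N -> dyadic_odd l x ->
  dyadic_floor l x = dyadic_floor l y -> zero_run x k = zero_run y k.
Proof.
move=> kl lodd xy.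
have xyE i : (i <= l)%N -> dyadic_odd i x = dyadic_odd i y.
  by move=> il; rewrite /dyadic_odd !(dyadic_floor_div i (l - i)) subnKC// xy.
have ex : exists n, dyadic_odd (k + n) x by exists (l - k)%N; rewrite subnKC.
case: (ex_minnP ex) => n nodd nmin.
have nl : (k + n <= l)%N by rewrite -leq_subRL// nmin// subnKC.
have even i : (i < n)%N -> ~~ dyadic_odd (k + i) x.
  by rewrite ltnNge; apply: contra => /nmin.
rewrite (zero_runE nodd even); apply/esym/zero_runE; first by rewrite -xyE.
by move=> i ilt; rewrite -xyE ?even//; lia.
Qed.

Lemma dyadic_odd_itv (a b : R) : a < b -> exists l m, odd `|m| /\
  forall x, dyadic_floor l x = m -> a <= x <= b.
Proof.
move=> ab; have ba0 : 0 < b - a by lra.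
(* Three dyadic steps of length [2 ^- l] fit into [b - a]: at most two lead from the floor of [a] to
   an odd [m], and the third covers the cell of [m]. *)
pose l := Num.bound (3 / (b - a)).
have : 3 / (b - a) < 2 ^+ l by exact: upper_nthrootP.
rewrite ltr_pdivrMr// => lab; set f := dyadic_floor l a.
have [m [modd fm mf]] : exists m, [/\ odd `|m|, f + 1 <= m & m <= f + 2].
  have [fodd|feven] := boolP (odd `|f|); [exists (f + 2)|exists (f + 1)];
    by split; lia.
have /dyadic_floorP/andP[fa af] := erefl f.
exists l, m; split=> // x /dyadic_floorP/andP[mx xm].
have p0 : 0 < 2 ^+ l :> R by rewrite exprn_gt0.
rewrite -(ler_pM2l p0) -(ler_pM2l p0 x).
move: fm mf; rewrite -!(ler_int R) !intrD => fm mf.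
rewrite !intrD in af xm; nra.
Qed.

Lemma nowhere_dense_zero_run (A : set (nat -> nat)) : sparse A ->
  nowhere_dense (zero_run @^-1` A).
Proof.
move=> sA; apply/nowhere_dense_itvP => a b /dyadic_odd_itv[l [m [modd lmab]]].
have p0 i : 0 < 2 ^+ i :> R by rewrite exprn_gt0.
pose x0 : R := m%:~R / 2 ^+ l.
have x0m : dyadic_floor l x0 = m.
  apply/dyadic_floorP.
  by rewrite /x0 mulrCA mulfV ?gt_eqF// mulr1 lexx ltr_int ltrDl.
pose t := mkseq (zero_run x0) l.+1; have [n nA] := sA t.
(* The digits of [m] are followed by [n] zeros and a 1, so that the run starting at [l.+1] has
   length [n]. *)
pose l' := (l.+1 + n)%N; pose m' : int := m * 2 ^+ n.+1 + 1.
have div x i j : dyadic_floor l' x = m' -> (i + j = n)%N ->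
    dyadic_floor (l + i) x = m * 2 ^+ i.
  move=> xm' ijn; rewrite (dyadic_floor_div _ j.+1).
  have -> : (l + i + j.+1 = l')%N by rewrite /l'; lia.
  rewrite xm' /m' -ijn -addnS exprD mulrA divzMDl ?expf_neq0//.
  rewrite divz_small ?addr0// abszX /=.
  by rewrite ltz_nat -{1}(expn0 2) ltn_exp2l.
have xm x : dyadic_floor l' x = m' -> dyadic_floor l x = m.
  by move=> /(div x 0 n)%N /(_ erefl); rewrite addn0 mulr1.
have zero_run_xn x : dyadic_floor l' x = m' -> ~ A (zero_run x).
  move=> xm'; apply/nA/basic_nbhs_rcons; rewrite size_mkseq.
    apply: (@eq_from_nth _ 0%N); rewrite ?size_mkseq// => k kl.
    rewrite !nth_mkseq//.
    by apply: (@zero_run_local l); rewrite // ?/dyadic_odd xm ?x0m.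
  apply: (@zero_runE _ _ n) => [|i ilt].
    rewrite /dyadic_odd -/l' xm' /m' exprS mulrCA; lia.
  rewrite /dyadic_odd addSnnS (div x i.+1 (n - i.+1)%N) ?subnKC//.
  by rewrite exprS mulrCA abszM oddM.
(* The term [1 / 2] keeps the closed interval inside the half-open dyadic cell of [m']. *)
have cd x : m'%:~R / 2 ^+ l' <= x <= (m'%:~R + 1 / 2) / 2 ^+ l' ->
    dyadic_floor l' x = m'.
  rewrite ler_pdivrMr// ler_pdivlMr// => /andP[c d].
  by apply/dyadic_floorP; rewrite mulrC c /= intrD (le_lt_trans d)//; lra.
have clt : m'%:~R / 2 ^+ l' < (m'%:~R + 1 / 2) / 2 ^+ l' :> R.
  by rewrite ltr_pM2r ?invr_gt0//; lra.
have in_ab x : m'%:~R / 2 ^+ l' <= x <= (m'%:~R + 1 / 2) / 2 ^+ l' ->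
    a <= x <= b by move=> /cd/xm/lmab.
exists (m'%:~R / 2 ^+ l'), ((m'%:~R + 1 / 2) / 2 ^+ l'); split=> //.
- have := in_ab (m'%:~R / 2 ^+ l').
  by rewrite lexx ltW// => /(_ isT)/andP[].
- have := in_ab ((m'%:~R + 1 / 2) / 2 ^+ l').
  by rewrite lexx ltW// => /(_ isT)/andP[].
- by move=> x /cd; exact: zero_run_xn.
Qed.

End real_to_baire.

(** * Colorings and covers by meager sets *)

Lemma cov_meager_coloring (R : realType) (F : set (set R)) (L : Type) :
    (forall A, F A -> meager A) -> \bigcup_(A in F) A = [set: R] ->
  F #= [set: L] -> exists c : (nat -> nat) -> L, coloring H_baire c.
Proof.
move=> Fm Fcov /card_eqPle[FL _].
have /choice[G GP] : forall A : set R, exists G : nat -> set R, F A ->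
    (forall n, nowhere_dense (G n)) /\ A = \bigcup_n G n.
  move=> A; have [/Fm[G GP]|nF] := pselect (F A); first by exists G.
  by exists (fun=> set0).
have /choice[An AnP] : forall b, exists An : set R * nat,
    F An.1 /\ G An.1 An.2 (baire_real R b).
  move=> b; have [A FA Ab] : (\bigcup_(A in F) A) (baire_real R b).
    by rewrite Fcov.
  have := Ab; rewrite {1}(GP A FA).2 => -[n _ Gb].
  by exists (A, n).
have /card_leTTP[j j_inj] : [set: F] #<= [set: L].
  by rewrite (card_le_eql (card_setT F)).
(* The color names a meager set and one of its nowhere dense pieces, so each nonempty fiber lies in
   the preimage of a single piece. *)
pose c b := (j (exist _ (An b).1 (mem_set (AnP b).1)), (An b).2).
have cP : coloring H_baire c.
  apply/coloringP => k.
  have [[b0 b0k]|nk] := pselect (exists b, c b = k); last first.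
    by move=> t; exists 0%N => b _ bk; apply: nk; exists b.
  have := sparse_baire_real ((GP _ (AnP b0).1).1 (An b0).2).
  apply: sparseS => b /=; rewrite -b0k => -[/j_inj [e1] e2].
  by have := (AnP b).2; rewrite e1 e2.
have /card_leTTP[f f_inj] := infinite_card_muln (coloring_infinite cP).
exists (f \o c) => e /cP nc [x ex]; apply: nc; exists (c (e 0%N)) => n.
by apply: f_inj; rewrite [LHS]ex -(ex 0%N).
Qed.

Lemma coloring_cov_meager (R : realType) (K : Type) (c : (nat -> nat) -> K) :
    coloring H_baire c ->
  let F := range (fun k => @zero_run R @^-1` (c @^-1` [set k])) in
  (forall A, F A -> meager A) /\ \bigcup_(A in F) A = [set: R].
Proof.
move=> /coloringP cP; split=> [_ [k _ <-]|].
  exists (fun=> @zero_run R @^-1` (c @^-1` [set k])).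
  split=> [_|]; first exact: nowhere_dense_zero_run.
  by rewrite bigcup_const//; exists 0%N.
rewrite -subTset => x _.
by exists (@zero_run R @^-1` (c @^-1` [set c (zero_run x)])).
Qed.

(** Replacing each color by a chosen point of its fiber turns any coloring into one with values in
    the Baire space, so it suffices to minimize over the ranges of such colorings. *)
Lemma exists_least_coloring : exists K : Type,
  (exists c : (nat -> nat) -> K, coloring H_baire c) /\
  forall L : Type, (exists d : (nat -> nat) -> L, coloring H_baire d) ->
    [set: K] #<= [set: L].
Proof.
pose I := {c : (nat -> nat) -> nat -> nat | coloring H_baire c}.
have i0 : I by exists id; exact: H_baire_nonconstant.
have [[c cP] cmin] := exists_least_card (fun i : I => range (sval i)) i0.
have cr b : c b \in range c by rewrite inE; exists b.
exists (range c); split.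
  exists (fun b => exist _ (c b) (cr b)) => e /cP nc [[x xr] ex].
  by apply: nc; exists x => n; have [] := ex n.
move=> L [d dP]; pose r l := xget (fun=> 0%N) [set b | d b = l].
have dr b : d (r (d b)) = d b.
  by apply: (@xgetPex _ _ [set b' | d b' = d b]); exists b.
have rP : coloring H_baire (r \o d).
  move=> e /dP nd [x ex]; apply: nd; exists (d x) => n.
  by rewrite -(ex n) /= dr.
apply: card_le_trans (cmin (exist _ _ rP)) _ => /=.
apply/card_leTTP; exists (fun x => d (val x)) => x y dxy; apply: val_inj.
have /set_mem[b _ bx] := valP x; have /set_mem[b' _ by'] := valP y.
by move: dxy; rewrite -bx -by' /= !dr => ->.
Qed.

Theorem proposition6p6 (R : realType) :
  exists K : Type, is_chromatic_number H_baire K /\ is_cov_meager R K.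
Proof.
have [K [[c cP] Kmin]] := exists_least_coloring.
exists K; split; first by split=> //; exists c.
split=> [|L [F [Fm Fcov FL]]]; last exact/Kmin/(cov_meager_coloring Fm Fcov).
have [Fm Fcov] := coloring_cov_meager R cP.
set F := (X in bigcup X _) in Fm Fcov.
exists F; split=> //; apply/card_eqPle; split; first exact: card_image_le.
(* Distinct colors may have equal preimages, so [F] could be smaller than [K]; but [F] is itself a
   possible set of colors, and [K] is least. *)
have [|d dP] := @cov_meager_coloring R F (set_type F) Fm Fcov.
  by rewrite card_eq_sym card_setT.
have := Kmin (set_type F) (ex_intro _ d dP).
by rewrite (card_le_eqr (card_setT F)).
Qed.
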